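(* Let $m,n,K$ be positive integers, $q=\min\{m,n\}$, $r\in\mathbb{R}$, and let $f:\Delta^q_+\to\mathbb{R}$ be a function whose lower-level sets $\{u\in\Delta^q_+\mid f(u)\le t\}$ are semidefinite-representable. Let $\bar S=\{M\in\mathcal{M}^{m,n}(\mathbb{R})\mid\mathrm{rank}(M)\le K,\ f(\sigma(M))\le r\}$. Then $\mathrm{conv}(\bar S)$ is semidefinite-representable.
   Context: $\Delta^q_+=\{x\in\mathbb{R}^q\mid x_1\ge\dots\ge x_q\ge0\}$. $\mathcal{M}^{m,n}(\mathbb{R})$ is the space of real $m\times n$ matrices and $\sigma(M)\in\mathbb{R}^q$ its vector of singular values in nonincreasing order. A set is semidefinite-representable if it is the projection of the solution set of a linear matrix inequality (i.e., of a set $\{(x,w)\mid A_0+\sum_i x_iA_i+\sum_j w_jB_j\succeq0\}$ with symmetric matrices $A_i,B_j$). *)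

(* Defs.v *)
(* Real numbers are modelled by an arbitrary real closed
   field R. *)
From HB Require Import structures.
From mathcomp Require Import all_boot all_order all_algebra.
Set Implicit Arguments. Unset Strict Implicit. Unset Printing Implicit Defensive.
Import Order.TTheory GRing.Theory Num.Theory.
Local Open Scope ring_scope.

Section Defs.
Variable R : rcfType.

Definition in_Delta_plus (q : nat) (x : 'rV[R]_q) : Prop :=
  (forall i j : 'I_q, (i <= j)%N -> x 0 j <= x 0 i) /\
  (forall i : 'I_q, 0 <= x 0 i).

Definition symmetric_mx (k : nat) (A : 'M[R]_k) : Prop := A^T = A.

Definition psd (k : nat) (A : 'M[R]_k) : Prop :=
  symmetric_mx A /\ forall v : 'cV[R]_k, 0 <= (v^T *m A *m v) 0 0.

Definition sdr (N : nat) (S : 'rV[R]_N -> Prop) : Prop :=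
  exists (p k : nat) (A0 : 'M[R]_k) (A : 'I_N -> 'M[R]_k) (B : 'I_p -> 'M[R]_k),
    symmetric_mx A0 /\ (forall i, symmetric_mx (A i)) /\
    (forall j, symmetric_mx (B j)) /\
    forall x : 'rV[R]_N,
      S x <-> exists w : 'rV[R]_p,
        psd (A0 + \sum_(i < N) x 0 i *: A i + \sum_(j < p) w 0 j *: B j).

Definition sdr_mx (m n : nat) (S : 'M[R]_(m, n) -> Prop) : Prop :=
  sdr (fun v : 'rV[R]_(m * n) => S (vec_mx v)).

Definition conv_hull (m n : nat) (S : 'M[R]_(m, n) -> Prop)
    (M : 'M[R]_(m, n)) : Prop :=
  exists (s : nat) (l : 'I_s -> R) (X : 'I_s -> 'M[R]_(m, n)),
    (forall i, 0 <= l i) /\ \sum_(i < s) l i = 1 /\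
    (forall i, S (X i)) /\ M = \sum_(i < s) l i *: X i.

Definition orthogonal_mx (k : nat) (U : 'M[R]_k) : Prop := U^T *m U = 1%:M.

Definition rect_diag (m n : nat) (x : 'rV[R]_(minn m n)) : 'M[R]_(m, n) :=
  \matrix_(i < m, j < n)
     \sum_(k < minn m n | (val i == val k) && (val j == val k)) x 0 k.

Definition is_sing_vals (m n : nat) (M : 'M[R]_(m, n)) (x : 'rV[R]_(minn m n))
  : Prop :=
  in_Delta_plus x /\
  exists (U : 'M[R]_m) (V : 'M[R]_n),
    orthogonal_mx U /\ orthogonal_mx V /\ M = U *m rect_diag x *m V^T.

Definition Sbar (m n K : nat) (f : 'rV[R]_(minn m n) -> R) (r : R)
    (M : 'M[R]_(m, n)) : Prop :=
  (\rank M <= K)%N /\ exists x, is_sing_vals M x /\ f x <= r.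

End Defs.

(* Main.v *)
Require Import Defs.
From HB Require Import structures.
From mathcomp Require Import all_boot all_order all_algebra all_fingroup.
From mathcomp Require Import complex ring lra.
Set Implicit Arguments. Unset Strict Implicit. Unset Printing Implicit Defensive.
Import Order.TTheory GRing.Theory Num.Theory.
Local Open Scope ring_scope.

(** The convex hull of [Sbar K f r] is the set of all M whose singular values are
    weakly majorized by some u in Delta_+ with f u <= r and u_k = 0 for k >= K.
    A Ky Fan norm constraint  sigma_0(M) + ... + sigma_c(M) <= s  is a linear
    matrix inequality with lifting variables Z, t: writing Y for the symmetric
    dilation [[0, M], [M^T, 0]], it says Z >= 0, Z + t I - Y >= 0 and
    tr Z + (c + 1) t <= s.  Hence the majorization set is semidefinite-
    representable; in particular it is convex, and as it contains [Sbar] it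
    contains the hull.  Conversely, if sigma(M) is weakly majorized by u, then
    sigma(M) is reached from u by convex combinations, coordinate permutations
    and sign changes, all of which preserve the hull of the orthogonally
    invariant set [Sbar]; the singular value decomposition transports this from
    diagonal matrices to M. *)

(** * Positive semidefinite matrices and their quadratic forms *)

Section PositiveSemidefinite.
Variable R : rcfType.
Implicit Types k : nat.

Definition qform k (A : 'M[R]_k) (v : 'cV[R]_k) : R := (v^T *m A *m v) 0 0.

Lemma qformD k (A B : 'M[R]_k) v : qform (A + B) v = qform A v + qform B v.
Proof. by rewrite /qform mulmxDr mulmxDl mxE. Qed.

Lemma qformZ k a (A : 'M[R]_k) v : qform (a *: A) v = a * qform A v.
Proof. by rewrite /qform -scalemxAr -scalemxAl mxE. Qed.

Lemma qform0 k v : qform (0 : 'M[R]_k) v = 0.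
Proof. by rewrite /qform mulmx0 mul0mx mxE. Qed.

Lemma qformx0 k (A : 'M[R]_k) : qform A 0 = 0.
Proof. by rewrite /qform mulmx0 mxE. Qed.

Lemma qform_sum (I : finType) (P : pred I) k (A : I -> 'M[R]_k) v :
  qform (\sum_(i | P i) A i) v = \sum_(i | P i) qform (A i) v.
Proof.
by rewrite (big_morph (fun A => qform A v) (id1 := 0) (op1 := +%R)
  (fun A B => qformD A B v) (qform0 v)).
Qed.

Lemma psd_qform k (A : 'M[R]_k) v : psd A -> 0 <= qform A v.
Proof. by case=> _; apply. Qed.

Lemma psdD k (A B : 'M[R]_k) : psd A -> psd B -> psd (A + B).
Proof.
move=> [sA pA] [sB pB]; split; first by rewrite /symmetric_mx linearD /= sA sB.
by move=> v; rewrite -/(qform _ _) qformD addr_ge0 ?pA ?pB.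
Qed.

Lemma psdZ k a (A : 'M[R]_k) : 0 <= a -> psd A -> psd (a *: A).
Proof.
move=> a0 [sA pA]; split; first by rewrite /symmetric_mx linearZ /= sA.
by move=> v; rewrite -/(qform _ _) qformZ mulr_ge0 ?pA.
Qed.

Lemma psd0 k : psd (0 : 'M[R]_k).
Proof. by split=> [|v]; rewrite ?/symmetric_mx ?trmx0 -?/(qform _ _) ?qform0. Qed.

Lemma psd_sum (I : finType) (P : pred I) k (A : I -> 'M[R]_k) :
  (forall i, P i -> psd (A i)) -> psd (\sum_(i | P i) A i).
Proof. by move=> pA; elim/big_ind: _ => //; [exact: psd0 | exact: psdD]. Qed.

Lemma psd_outer k (w : 'cV[R]_k) : psd (w *m w^T).
Proof.
split; first by rewrite /symmetric_mx trmx_mul trmxK.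
move=> v; have -> : v^T *m (w *m w^T) *m v = (w^T *m v)^T *m (w^T *m v).
  by rewrite trmx_mul trmxK !mulmxA.
by rewrite mxE big_ord1 mxE -expr2 sqr_ge0.
Qed.

Lemma psd_congr k l (Q : 'M[R]_(k, l)) (A : 'M[R]_l) :
  psd A -> psd (Q *m A *m Q^T).
Proof.
case=> sA pA; split; first by rewrite /symmetric_mx !trmx_mul trmxK sA mulmxA.
move=> v; have := pA (Q^T *m v).
by rewrite trmx_mul trmxK !mulmxA.
Qed.

Lemma psd_scalar1 (a : R) : psd (a%:M : 'M_1) <-> 0 <= a.
Proof.
split=> [[_ /(_ 1%:M)]|a0].
  by rewrite trmx1 mul1mx mulmx1 mxE eqxx mulr1n.
split; first by rewrite /symmetric_mx tr_scalar_mx.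
move=> v; rewrite -mulmxA mul_scalar_mx -scalemxAr mxE mulr_ge0 //.
by rewrite mxE big_ord1 mxE -expr2 sqr_ge0.
Qed.

(** Through block-diagonal matrices, several linear matrix inequalities merge into a single one. *)
Lemma psd_block_diag k l (A : 'M[R]_k) (B : 'M[R]_l) :
  psd (block_mx A 0 0 B) <-> psd A /\ psd B.
Proof.
have qf a b : ((col_mx a b)^T *m block_mx A 0 0 B *m col_mx a b) 0 0
    = qform A a + qform B b.
  by rewrite /qform tr_col_mx mul_row_block !mulmx0 addr0 add0r mul_row_col mxE.
split=> [[]|[[sA pA] [sB pB]]].
  rewrite /symmetric_mx tr_block_mx !trmx0 => /eq_block_mx[sA _ _ sB] p.
  split; split=> // v; [have := p (col_mx v 0)|have := p (col_mx 0 v)].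
    by rewrite qf qformx0 addr0.
  by rewrite qf qformx0 add0r.
split; first by rewrite /symmetric_mx tr_block_mx !trmx0 sA sB.
by move=> v; rewrite -[v]vsubmxK qf addr_ge0 ?pA ?pB.
Qed.

End PositiveSemidefinite.

(** * Closure properties of semidefinite-representable sets *)

Section LMI.
Import VectorInternalTheory.
Variable R : rcfType.

(* Coordinate-free version of [sdr]: lifting variables range over any finite-
   dimensional space, so products and linear preimages need no indexing. *)
Definition lmi_rep (V : lmodType R) (S : V -> Prop) : Prop :=
  exists (W : vectType R) (k : nat) (A0 : 'M[R]_k) (L : V * W -> 'M[R]_k),
    [/\ symmetric_mx A0, linear L, forall z, symmetric_mx (L z) &
        forall x, S x <-> exists w, psd (A0 + L (x, w))].

Lemma lmi_rep_ext (V : lmodType R) (S T : V -> Prop) :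
  (forall x, S x <-> T x) -> lmi_rep S -> lmi_rep T.
Proof.
move=> eST [W [k [A0 [L [sA lL sL SE]]]]]; exists W, k, A0, L; split=> // x.
by rewrite -eST.
Qed.

Lemma lmi_rep_psd (V : lmodType R) k (F : V -> 'M[R]_k) :
  linear F -> (forall x, symmetric_mx (F x)) -> lmi_rep (fun x => psd (F x)).
Proof.
move=> lF sF; exists 'rV[R]_0, k, 0, (fun z => F z.1); split=> //.
- by rewrite /symmetric_mx trmx0.
- by move=> a u v /=; rewrite lF.
- by move=> x; split=> [p|[w]]; rewrite ?add0r //; exists 0; rewrite add0r.
Qed.

Lemma lmi_rep_ge0 (V : lmodType R) (F : V -> R^o) :
  linear F -> lmi_rep (fun x => 0 <= F x).
Proof.
move=> lF.
apply: (@lmi_rep_ext _ (fun x => psd ((F x)%:M : 'M_1))); last apply: lmi_rep_psd.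
- by move=> x; rewrite psd_scalar1.
- by move=> a u v /=; rewrite lF raddfD /= scale_scalar_mx.
- by move=> x; rewrite /symmetric_mx tr_scalar_mx.
Qed.

(** The two inequalities become the diagonal blocks of one, each with its own lifting variables. *)
Lemma lmi_rep_and (V : lmodType R) (S T : V -> Prop) :
  lmi_rep S -> lmi_rep T -> lmi_rep (fun x => S x /\ T x).
Proof.
move=> [W [k [A0 [L [sA lL sL SE]]]]] [W' [k' [A0' [L' [sA' lL' sL' TE]]]]].
exists (W * W')%type, (k + k')%N, (block_mx A0 0 0 A0'),
  (fun z => block_mx (L (z.1, z.2.1)) 0 0 (L' (z.1, z.2.2))); split.
- by rewrite /symmetric_mx tr_block_mx !trmx0 sA sA'.
- move=> a [x [w w']] [y [v v']] /=.
  rewrite scale_block_mx add_block_mx !scaler0 !addr0.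
  by congr block_mx; [rewrite -lL | rewrite -lL'].
- by move=> z; rewrite /symmetric_mx tr_block_mx !trmx0 sL sL'.
- move=> x; rewrite SE TE; split=> [[[w p] [w' p']]|[[w w']]].
    by exists (w, w'); rewrite add_block_mx !addr0 psd_block_diag.
  rewrite add_block_mx !addr0 psd_block_diag /= => -[p p'].
  by split; [exists w | exists w'].
Qed.

Lemma lmi_rep_preim (V U : lmodType R) (g : U -> V) (S : V -> Prop) :
  linear g -> lmi_rep S -> lmi_rep (fun x => S (g x)).
Proof.
move=> lg [W [k [A0 [L [sA lL sL SE]]]]].
exists W, k, A0, (fun z => L (g z.1, z.2)); split=> // a u v.
by rewrite /= lg -lL.
Qed.

(** The component projected away joins the lifting variables. *)
Lemma lmi_rep_proj (V : lmodType R) (U : vectType R) (S : V * U -> Prop) :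
  lmi_rep S -> lmi_rep (fun x => exists u, S (x, u)).
Proof.
move=> [W [k [A0 [L [sA lL sL SE]]]]].
exists (U * W)%type, k, A0, (fun z => L ((z.1, z.2.1), z.2.2)).
split=> // [a u v|x]; first by rewrite /= -lL.
split=> [[u /SE[w p]]|[[u w] p]]; first by exists (u, w).
by exists u; apply/SE; exists w.
Qed.

Lemma lmi_rep_all (V : lmodType R) (I : finType) (S : I -> V -> Prop) :
  (forall i, lmi_rep (S i)) -> lmi_rep (fun x => forall i, S i x).
Proof.
move=> rS.
suff rs (s : seq I) : lmi_rep (fun x => forall i, i \in s -> S i x).
  apply: lmi_rep_ext (rs (enum I)) => x.
  by split=> h i; [apply: h; rewrite mem_enum | rewrite mem_enum].
elim: s => [|i s IHs].
  (* The empty conjunction is represented by the inequality [0 <= 0]. *)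
  have : lmi_rep (fun x : V => 0 <= (0 : R^o)).
    by apply: (@lmi_rep_ge0 _ (fun=> 0)) => a u v; rewrite scaler0 addr0.
  by apply: lmi_rep_ext => x; split.
apply: lmi_rep_ext (lmi_rep_and (rS i) IHs) => x; split.
  by move=> [Si Ss] j; rewrite inE => /predU1P[->|/Ss].
by move=> Ss; split=> [|j js]; apply: Ss; rewrite inE ?eqxx ?js ?orbT.
Qed.

Lemma linear_sumZ (V U : lmodType R) (L : V -> U) (I : finType)
    (a : I -> R) (x : I -> V) :
  linear L -> L (\sum_i a i *: x i) = \sum_i a i *: L (x i).
Proof.
move=> lL; have L0 : L 0 = 0.
  by have := lL (-1) 0 0; rewrite !scaleN1r oppr0 addr0 addNr.
by elim/big_rec2: _ => // i y z _ <-; rewrite lL.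
Qed.

(** The lifting witnesses are averaged with the same weights. As these sum to 1, the affine matrix
    expression at the average is the average of positive semidefinite matrices. *)
Lemma lmi_rep_convex (V : lmodType R) (S : V -> Prop) s (l : 'I_s -> R)
    (X : 'I_s -> V) : lmi_rep S -> (forall i, 0 <= l i) ->
  \sum_i l i = 1 -> (forall i, S (X i)) -> S (\sum_i l i *: X i).
Proof.
move=> [W [k [A0 [L [sA lL sL SE]]]]] l0 l1 SX.
have /fin_all_exists[w pw] i : exists w, psd (A0 + L (X i, w)) by apply/SE.
apply/SE; exists (\sum_i l i *: w i).
have -> : (\sum_i l i *: X i, \sum_i l i *: w i) = \sum_i l i *: (X i, w i).
  rewrite [RHS]surjective_pairing; congr pair.
    by rewrite (big_morph (fun z : V * W => z.1) (id1 := 0) (op1 := +%R)).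
  by rewrite (big_morph (fun z : V * W => z.2) (id1 := 0) (op1 := +%R)).
rewrite linear_sumZ // -[A0]scale1r -l1 scaler_suml -big_split /=.
by apply: psd_sum => i _; rewrite -scalerDr; apply: psdZ.
Qed.

Lemma sdr_lmi_rep N (S : 'rV[R]_N -> Prop) : sdr S <-> lmi_rep S.
Proof.
split.
  move=> [p [k [A0 [A [B [sA0 [sA [sB SE]]]]]]]].
  exists 'rV[R]_p, k, A0, 
    (fun z : 'rV[R]_N * 'rV[R]_p => \sum_i z.1 0 i *: A i + \sum_j z.2 0 j *: B j).
  split=> //.
  - move=> a u v /=; rewrite scalerDr addrACA !scaler_sumr -!big_split /=.
    by congr (_ + _); apply: eq_bigr => i _; rewrite !mxE scalerDl scalerA.
  - move=> z; rewrite /symmetric_mx linearD /= !linear_sum /=.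
    congr (_ + _); apply: eq_bigr => i _.
      by rewrite linearZ /= sA.
    by rewrite linearZ /= sB.
  - by move=> x; rewrite SE; split=> -[w pw]; exists w; move: pw; rewrite addrA.
move=> [W [k [A0 [L [sA lL sL SE]]]]].
(* The coefficient matrices are the values of [L] on the standard basis of the row space and on the
   basis of [W] that corresponds to it under [r2v]. *)
exists (dim W), k, A0, (fun i => L (delta_mx 0 i, 0)),
   (fun j => L (0, r2v (delta_mx 0 j))).
do 3! [split=> //]; move=> x; rewrite SE.
have LE w : L (x, r2v w) = \sum_(i < N) x 0 i *: L (delta_mx 0 i, 0) +
    \sum_j w 0 j *: L (0, r2v (delta_mx 0 j)).
  have -> : (x, r2v w) = 1 *: (x, 0) + (0, r2v w).
    by rewrite scale1r; congr pair; rewrite /= ?addr0 ?add0r.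
  rewrite lL scale1r; congr (_ + _).
    rewrite -(@linear_sumZ _ _ (fun x => L (x, 0))); first by rewrite -row_sum_delta.
    move=> a u v; rewrite -lL; congr L.
    by congr pair; rewrite /= scaler0 addr0.
  rewrite -(@linear_sumZ _ _ (fun w => L (0, r2v w))); first by rewrite -row_sum_delta.
  move=> a u v; rewrite -lL; congr L.
  by congr pair; rewrite /= ?linearP // scaler0 addr0.
split=> -[w pw].
  by exists (v2r w); rewrite -addrA -LE v2rK.
by exists (r2v w); rewrite LE addrA.
Qed.

End LMI.

(** * Orthogonal matrices and the singular value decomposition *)

Section SVD.
Variable R : rcfType.

Lemma dot_sqr_gt0 n (v : 'cV[R]_n) : v != 0 -> 0 < (v^T *m v) 0 0.
Proof.
move=> v0; rewrite mxE.
have ge0 i : true -> 0 <= v^T 0 i * v i 0 by move=> _; rewrite mxE -expr2 sqr_ge0.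
rewrite lt_neqAle sumr_ge0 // andbT eq_sym psumr_eq0 //.
apply: contra v0 => /allP h; apply/eqP/colP => i.
have := h i (mem_index_enum i); by rewrite !mxE /= -expr2 sqrf_eq0 => /eqP.
Qed.

Lemma normalize_cV n (v : 'cV[R]_n) : v != 0 ->
  exists2 c, c != 0 & (c *: v)^T *m (c *: v) = 1%:M.
Proof.
move=> /dot_sqr_gt0; set s := (_ *m _) 0 0 => s0; exists (Num.sqrt s)^-1.
  by rewrite invr_eq0 gt_eqF ?sqrtr_gt0.
rewrite [(_ *: v)^T]linearZ /= -scalemxAl -scalemxAr scalerA [v^T *m v]mx11_scalar -/s.
by rewrite scale_scalar_mx -expr2 exprVn sqr_sqrtr ?ltW // mulVf ?gt_eqF.
Qed.

Lemma tr_mx11 (M : 'M[R]_1) : M^T = M.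
Proof. by rewrite [M]mx11_scalar tr_scalar_mx. Qed.

(** The characteristic polynomial has a root [al + i be] over the complex extension of [R], with a
    row eigenvector [a + i b]. Symmetry forces [be = 0], so whichever of [a], [b] is nonzero is a
    real eigenvector. *)
Lemma symmetric_eigenvector n (A : 'M[R]_n.+1) : symmetric_mx A ->
  exists l (v : 'cV[R]_n.+1), v^T *m v = 1%:M /\ A *m v = l *: v.
Proof.
move=> sA; pose Ac := map_mx (complex.real_complex R) A.
have /closed_rootP[mu] : size (char_poly Ac) != 1 by rewrite size_char_poly.
rewrite -eigenvalue_root_char => /eigenvalueP[w wA w0].
pose a := map_mx (@complex.Re R) w; pose b := map_mx (@complex.Im R) w.
pose al := complex.Re mu; pose be := complex.Im mu.
have aA : a *m A = al *: a - be *: b.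
  apply/rowP=> j; move/rowP/(_ j): wA; rewrite !mxE => /(congr1 (@complex.Re R)).
  rewrite raddf_sum /= /al /be; case: (mu) (w 0 j) => m1 m2 [w1 w2] /= <-.
  apply: eq_bigr => k _; rewrite !mxE; case: (w 0 k) => x y /=.
  by rewrite mulr0 subr0.
have bA : b *m A = al *: b + be *: a.
  apply/rowP=> j; move/rowP/(_ j): wA; rewrite !mxE => /(congr1 (@complex.Im R)).
  rewrite raddf_sum /= /al /be; case: (mu) (w 0 j) => m1 m2 [w1 w2] /= <-.
  apply: eq_bigr => k _; rewrite !mxE; case: (w 0 k) => x y /=.
  by rewrite mulr0 add0r.
have ab0 : (a != 0) || (b != 0).
  rewrite -negb_and; apply: contra w0 => /andP[/eqP/rowP a0 /eqP/rowP b0].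
  apply/eqP/rowP=> j; have := a0 j; have := b0 j; rewrite !mxE.
  by case: (w 0 j) => x y /= -> ->.
have ge0 (x : 'rV[R]_n.+1) : 0 <= (x *m x^T) 0 0.
  by rewrite mxE sumr_ge0 // => i _; rewrite mxE -expr2 sqr_ge0.
have gt0 (x : 'rV[R]_n.+1) : x != 0 -> 0 < (x *m x^T) 0 0.
  by move=> x0; have := @dot_sqr_gt0 _ x^T; rewrite trmxK trmx_eq0; apply.
have be0 : be = 0.
  (* Expanding both sides of this equality leaves [be] times the sum of the squared norms of [a] and
     [b] equal to 0. *)
  have ab : a *m A *m b^T = b *m A *m a^T.
    by rewrite -[LHS]tr_mx11 !trmx_mul trmxK sA mulmxA.
  have ba : b *m a^T = a *m b^T by rewrite -[RHS]tr_mx11 trmx_mul trmxK.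
  move: ab; rewrite aA bA mulmxBl mulmxDl -!scalemxAl ba => /eqP.
  rewrite -subr_eq0 opprD addrACA subrr add0r -opprD -scalerDr oppr_eq0 scaler_eq0.
  case/orP=> [/eqP //|/eqP/matrixP/(_ 0 0)]; rewrite mxE [RHS]mxE => /eqP.
  rewrite paddr_eq0 //; case/andP=> /eqP ea /eqP eb; case/orP: ab0 => /gt0.
    by rewrite eb ltxx.
  by rewrite ea ltxx.
suff [x x0 xA] : exists2 x : 'rV[R]_n.+1, x != 0 & x *m A = al *: x.
  have /normalize_cV[c _ cx] : x^T != 0 by rewrite trmx_eq0.
  exists al, (c *: x^T); split=> //.
  by rewrite -scalemxAr -[A in LHS]sA -trmx_mul xA linearZ /= !scalerA mulrC.
case/orP: ab0 => n0; [exists a | exists b] => //.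
  by rewrite aA be0 scale0r subr0.
by rewrite bA be0 scale0r addr0.
Qed.

Lemma orthogonal_mulV k (U : 'M[R]_k) : orthogonal_mx U -> U *m U^T = 1%:M.
Proof. exact: mulmx1C. Qed.

Lemma orthogonalM k (U V : 'M[R]_k) :
  orthogonal_mx U -> orthogonal_mx V -> orthogonal_mx (U *m V).
Proof.
move=> oU oV.
by rewrite /orthogonal_mx trmx_mul mulmxA -[_ *m U]mulmxA oU mulmx1.
Qed.

Lemma orthogonal_tr k (U : 'M[R]_k) : orthogonal_mx U -> orthogonal_mx U^T.
Proof. by move=> oU; rewrite /orthogonal_mx trmxK orthogonal_mulV. Qed.

Lemma orthogonal1 k : orthogonal_mx (1%:M : 'M[R]_k).
Proof. by rewrite /orthogonal_mx trmx1 mulmx1. Qed.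

Lemma orthogonal_perm k (s : 'S_k) : orthogonal_mx (perm_mx s : 'M[R]_k).
Proof. by rewrite /orthogonal_mx tr_perm_mx -perm_mxM mulVg perm_mx1. Qed.

Lemma orthogonal_block k l (U : 'M[R]_k) (V : 'M[R]_l) :
  orthogonal_mx U -> orthogonal_mx V -> orthogonal_mx (block_mx U 0 0 V).
Proof.
move=> oU oV; rewrite /orthogonal_mx tr_block_mx !trmx0 mulmx_block.
by rewrite !mulmx0 !mul0mx !addr0 add0r oU oV -scalar_mx_block.
Qed.

Lemma orthogonal_lift0 k (U : 'M[R]_k) :
  orthogonal_mx U -> orthogonal_mx (lift0_mx U).
Proof. exact/orthogonal_block/orthogonal1. Qed.

(* The Householder reflection in the hyperplane bisecting e_0 and v. *)
Lemma orthogonal_first_col n (v : 'cV[R]_n.+1) : v^T *m v = 1%:M ->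
  exists2 H : 'M[R]_n.+1, orthogonal_mx H & H *m delta_mx 0 0 = v.
Proof.
move=> v1; pose e : 'cV[R]_n.+1 := delta_mx 0 0.
have [->|] := eqVneq v e.
  by exists 1%:M; [exact: orthogonal1 | rewrite mul1mx].
rewrite -subr_eq0 => /dot_sqr_gt0; set w := v - e; set s := (_ *m _) 0 0 => s0.
have e1 : e^T *m e = 1%:M.
  by rewrite trmx_delta mul_delta_mx; apply/matrixP=> i j; rewrite !ord1 !mxE.
have ww : w^T *m w = s%:M by rewrite [LHS]mx11_scalar.
pose H := 1%:M - (2 / s) *: (w *m w^T).
have HT : H^T = H by rewrite linearB /= trmx1 linearZ /= trmx_mul trmxK.
have wwww : (w *m w^T) *m (w *m w^T) = s *: (w *m w^T).
  by rewrite mulmxA -[w *m _ *m w]mulmxA ww mul_mx_scalar -scalemxAl.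
exists H.
  rewrite /orthogonal_mx HT mulmxBl mul1mx mulmxBr mulmx1 -scalemxAl -scalemxAr.
  rewrite wwww !scalerA.
  have -> : 2 / s * (2 / s) * s = 2 / s + 2 / s by field; rewrite gt_eqF.
  by rewrite scalerDl opprB addrK subrK.
have we : w^T *m e = (- (s / 2))%:M.
  have ev : e^T *m v = v^T *m e.
    by rewrite -[LHS]tr_mx11 trmx_mul trmxK.
  move: ww; rewrite /w [(v - e)^T]linearB /= mulmxBl !mulmxBr v1 e1 ev.
  move=> /(congr1 (fun M : 'M_1 => M 0 0)); rewrite [RHS]mxE mulr1n => sE.
  rewrite -sE [LHS]mulmxBl e1 [v^T *m e]mx11_scalar.
  move: ((v^T *m e) 0 0) => c; apply/matrixP=> i j.
  by rewrite !ord1 !mxE !mulr1n; field.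
rewrite mulmxBl mul1mx -scalemxAl -mulmxA we mul_mx_scalar scalerA.
have -> : 2 / s * - (s / 2) = -1 by field; rewrite gt_eqF.
by rewrite scaleN1r opprK addrC subrK.
Qed.

(** Induction on the number of columns. Let [v] be a unit eigenvector of [M^T *m M] and [H]
    orthogonal with first column [v]. If [M *m v = 0], the first column of [M *m H] vanishes and the
    others are diagonalized recursively. Otherwise let [G] be orthogonal with first column [M *m v]
    normalized: the first row and column of [G^T *m M *m H] vanish outside the corner, and the
    remaining block is diagonalized recursively. *)
Lemma orthogonal_diagonalization n m (M : 'M[R]_(m, n)) :
  exists U V, [/\ orthogonal_mx U, orthogonal_mx V &
                  is_diag_mx (U^T *m M *m V)].
Proof.
elim: n m M => [|n IHn] m M.
  exists 1%:M, 1%:M; split; [exact: orthogonal1..|].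
  by apply/is_diag_mxP=> i [].
have [l [v [v1 vl]]] : exists l (v : 'cV[R]_n.+1),
    v^T *m v = 1%:M /\ M^T *m M *m v = l *: v.
  by apply: symmetric_eigenvector; rewrite /symmetric_mx trmx_mul trmxK.
have [H oH He] := orthogonal_first_col v1.
have [Mv0|] := eqVneq (M *m v) 0.
  (* [N] is [M *m H] with its column count read as [1 + n], so that block operations apply. *)
  have [N ND] : {N : 'M_(m, 1 + n) | M *m H = N} by exists (M *m H).
  have NE : N = row_mx 0 (rsubmx N).
    rewrite -[LHS]hsubmxK; congr row_mx; apply/colP=> i.
    have /colP/(_ i) : col 0 N = 0 by rewrite colE -ND -mulmxA He.
    by rewrite !mxE => <-; congr (N _ _); apply: val_inj.
  have [U [V [oU oV dD]]] := IHn _ (rsubmx N).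
  (* The leading zero column puts the recursive diagonal one place too far right; this cyclic shift
     moves the zero column to the end. *)
  pose s := perm (@ordS_inj n.+1).
  exists U, (H *m lift0_mx V *m perm_mx s^-1).
  split=> //.
    apply: orthogonalM (orthogonal_perm _); apply: orthogonalM oH _.
    exact: orthogonal_lift0 oV.
  have UNV : U^T *m N *m lift0_mx V = row_mx 0 (U^T *m rsubmx N *m V).
    rewrite {1}NE mul_mx_row mul_row_block.
    by rewrite !(mulmx0, mul0mx, addr0, add0r).
  have -> : U^T *m M *m (H *m lift0_mx V *m perm_mx s^-1)
      = col_perm s (row_mx (0 : 'cV_m) (U^T *m rsubmx N *m V)).
    rewrite col_permE !mulmxA -[_ *m M *m H]mulmxA ND; congr (_ *m _); exact: UNV.
  apply/is_diag_mxP=> i j ij; rewrite mxE permE.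
  have [jn|jn] := ltnP j n.
    have -> : ordS j = rshift 1 (Ordinal jn).
      by apply: val_inj; rewrite /= modn_small // ltnS.
    by apply: etrans (row_mxEr _ _ _ _) _; move/is_diag_mxP: dD; apply.
  have -> : ordS j = lshift n (0 : 'I_1).
    apply: val_inj => /=; have -> : (j : nat) = n.
      by apply/eqP; rewrite eqn_leq jn -ltnS ltn_ord.
    by rewrite modnn.
  by apply: etrans (row_mxEl _ _ _ _) _; rewrite mxE.
(* Since [M *m v] is nonzero here, there is at least one row. *)
case: m M vl => [|m] M vl; first by rewrite flatmx0 eqxx.
move=> /normalize_cV[c c0]; set u := c *: _ => u1.
have [G oG Ge] := orthogonal_first_col u1.
have GTu : G^T *m u = delta_mx 0 0 by rewrite -Ge mulmxA oG mul1mx.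
have HTv : v^T *m H = delta_mx 0 0.
  by rewrite -He trmx_mul -mulmxA oH mulmx1 trmx_delta.
have Ne : col 0 (G^T *m M *m H) = c^-1 *: delta_mx 0 0.
  by rewrite colE -[_ *m H *m _]mulmxA He -GTu -mulmxA scalemxAr scalerA mulVf ?scale1r.
(* The eigenvector equation enters here: [u^T *m M] is [c * l] times [v^T], which [H] sends to a
   multiple of the first basis row. *)
have eN : row 0 (G^T *m M *m H) = (c * l) *: (delta_mx 0 0 : 'rV_n.+1).
  rewrite rowE; have -> : (delta_mx 0 0 : 'rV_m.+1) = (G^T *m u)^T by rewrite GTu trmx_delta.
  rewrite trmx_mul trmxK !mulmxA -[_ *m G *m _]mulmxA orthogonal_mulV // mulmx1.
  rewrite linearZ /= trmx_mul -2!scalemxAl -[_ *m _ *m M]mulmxA.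
  have -> : v^T *m (M^T *m M) = l *: v^T.
    by rewrite -[RHS]linearZ /= -vl !trmx_mul trmxK.
  by rewrite -scalemxAl HTv scalerA.
have [N ND] : {N : 'M_(1 + m, 1 + n) | G^T *m M *m H = N}.
  by exists (G^T *m M *m H).
rewrite ND in Ne eN.
have NE : N = block_mx (ulsubmx N) 0 0 (drsubmx N).
  rewrite -[LHS]submxK; congr block_mx.
    apply/matrixP=> i j; rewrite ord1; move/rowP/(_ (rshift 1 j)): eN.
    rewrite !mxE /= mulr0 => <-; congr (N _ _); exact: val_inj.
  apply/matrixP=> i j; rewrite ord1; move/colP/(_ (rshift 1 i)): Ne.
  rewrite !mxE /= mulr0 => <-; congr (N _ _); exact: val_inj.
have [U [V [oU oV dD]]] := IHn _ (drsubmx N).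
exists (G *m lift0_mx U), (H *m lift0_mx V); split.
- exact: orthogonalM oG (orthogonal_lift0 oU).
- exact: orthogonalM oH (orthogonal_lift0 oV).
have UNV : (lift0_mx U)^T *m N *m lift0_mx V
    = block_mx (ulsubmx N) 0 0 (U^T *m drsubmx N *m V).
  rewrite {1}NE tr_block_mx !trmx0 trmx1 !mulmx_block.
  by rewrite !(mulmx0, mul0mx, addr0, add0r, mul1mx, mulmx1).
have -> : (G *m lift0_mx U)^T *m M *m (H *m lift0_mx V)
    = block_mx (ulsubmx N) 0 0 (U^T *m drsubmx N *m V) :> 'M_(1 + m, 1 + n).
  rewrite trmx_mul !mulmxA -[_ *m G^T *m M]mulmxA -[_ *m (G^T *m M) *m H]mulmxA.
  by rewrite ND; exact: UNV.
have : is_diag_mx (block_mx (ulsubmx N) 0 0 (U^T *m drsubmx N *m V)).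
  by rewrite is_diag_block_mx // !eqxx mx11_is_diag dD.
exact.
Qed.

Lemma rect_diag_id m n (x : 'rV[R]_(minn m n)) (k : 'I_(minn m n))
    (i : 'I_m) (j : 'I_n) :
  i = k :> nat -> j = k :> nat -> rect_diag x i j = x 0 k.
Proof.
move=> ik jk; rewrite mxE (big_pred1 k) // => l.
by rewrite /= ik jk andbb eq_sym.
Qed.

Lemma rect_diag_off m n (x : 'rV[R]_(minn m n)) (i : 'I_m) (j : 'I_n) :
  i != j :> nat -> rect_diag x i j = 0.
Proof.
move=> ij; rewrite mxE big_pred0 // => k.
by apply: contraNF ij => /andP[/eqP -> /eqP ->].
Qed.

Lemma is_diag_rect_diag m n (D : 'M[R]_(m, n)) :
  is_diag_mx D -> exists x, D = rect_diag x.
Proof.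
move=> /is_diag_mxP dD.
exists (\row_k D (widen_ord (geq_minl m n) k) (widen_ord (geq_minr m n) k)).
apply/matrixP=> i j; have [ij|ij] := eqVneq (i : nat) j; last first.
  by rewrite dD // rect_diag_off.
have iq : (i < minn m n)%N by rewrite leq_min ltn_ord ij ltn_ord.
rewrite (@rect_diag_id _ _ _ (Ordinal iq)) // mxE.
by congr (D _ _); apply: val_inj.
Qed.

Lemma rect_diag_sign m n (c : pred 'I_(minn m n)) (x : 'rV[R]_(minn m n)) :
  exists2 U, orthogonal_mx U &
    rect_diag (\row_k ((-1) ^+ c k * x 0 k)) = U *m rect_diag x.
Proof.
(* Row indices beyond the diagonal get the default [false], that is the sign +1. *)
pose b (i : 'I_m) := oapp c false (insub (val i)).
exists (diag_mx (\row_i (-1) ^+ b i)).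
  rewrite /orthogonal_mx tr_diag_mx mul_diag_mx.
  apply/matrixP=> i j; rewrite !mxE; case: eqP => [->|]; last by rewrite mulr0.
  by rewrite -expr2 sqrr_sign.
rewrite mul_diag_mx; apply/matrixP=> i j; rewrite !mxE big_distrr /=.
apply: eq_bigr => k /andP[/eqP ik _].
by rewrite mxE /b /= ik valK.
Qed.

(** Extension of [s] by the identity: [insub] fails exactly on the indices that are at least [q],
    and these are fixed. *)
Definition widen_perm_fun q m (h : (q <= m)%N) (s : 'S_q) (i : 'I_m) : 'I_m :=
  oapp (fun k => widen_ord h (s k)) i (insub (val i)).

Lemma widen_perm_funK q m (h : (q <= m)%N) (s t : 'S_q) :
  cancel s t -> cancel (widen_perm_fun h s) (widen_perm_fun h t).
Proof.
move=> st i; rewrite {2}/widen_perm_fun; case: insubP => [k _ ki|iq] /=.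
  by rewrite /widen_perm_fun /= valK /= st; apply: val_inj.
by rewrite /widen_perm_fun insubN.
Qed.

Lemma widen_perm_exists q m (h : (q <= m)%N) (s : 'S_q) :
  exists t : 'S_m, forall k, t (widen_ord h k) = widen_ord h (s k).
Proof.
exists (perm (can_inj (widen_perm_funK h (permK s)))) => k.
by rewrite permE /widen_perm_fun /= valK.
Qed.

Lemma rect_diag_perm m n (s : 'S_(minn m n)) (x : 'rV[R]_(minn m n)) :
  exists U V, [/\ orthogonal_mx U, orthogonal_mx V &
    rect_diag (\row_k x 0 (s k)) = U *m rect_diag x *m V^T].
Proof.
have [t tE] := widen_perm_exists (geq_minl m n) s.
have [t' tE'] := widen_perm_exists (geq_minr m n) s.
exists (perm_mx t), (perm_mx t'); split; [exact: orthogonal_perm..|].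
rewrite tr_perm_mx -row_permE -col_permE; apply/matrixP=> i j.
rewrite !mxE [RHS](reindex_inj (@perm_inj _ s)) /=.
have eqP1 k : (t i == s k :> nat) = (i == k :> nat).
  by rewrite -[_ == _ :> nat]/(t i == widen_ord (geq_minl m n) (s k)) -tE
             (inj_eq perm_inj).
have eqP2 k : (t' j == s k :> nat) = (j == k :> nat).
  by rewrite -[_ == _ :> nat]/(t' j == widen_ord (geq_minr m n) (s k)) -tE'
             (inj_eq perm_inj).
by apply: eq_big => k; rewrite ?eqP1 ?eqP2 // mxE.
Qed.

Lemma row_sort q (x : 'rV[R]_q) :
  exists s : 'S_q, forall i j : 'I_q, (i <= j)%N -> x 0 (s j) <= x 0 (s i).
Proof.
pose t := [tuple x 0 i | i < q].
have /tuple_permP[s sE] : perm_eq (sort (>=%R) t) t by rewrite perm_sort.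
exists s => i j ij.
have st : sorted (>=%R) (sort (>=%R) t) by apply: sort_sorted => a b; exact: le_total.
have nthE (k : 'I_q) : x 0 (s k) = nth 0 (sort (>=%R) t) k.
  by rewrite sE -tnth_nth !tnth_mktuple.
have sz : size (sort (>=%R) t) = q by rewrite size_sort size_tuple.
rewrite !nthE; apply: (sorted_leq_nth _ _ 0 st) => //; rewrite ?inE ?sz //.
- by move=> a b c ba ac; apply: le_trans ac ba.
- exact: lexx.
Qed.

(** Orthogonal diagonalization leaves the diagonal with arbitrary signs and order. The signs go into
    the left factor, and sorting is a permutation of rows and columns. *)
Lemma svd_exists m n (M : 'M[R]_(m, n)) : exists x, is_sing_vals M x.
Proof.
have [U [V [oU oV /is_diag_rect_diag[d dE]]]] := orthogonal_diagonalization M.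
pose e : 'rV[R]_(minn m n) := \row_k `|d 0 k|.
have [S oS eE] : exists2 S, orthogonal_mx S & rect_diag e = S *m rect_diag d.
  have [S oS SE] := rect_diag_sign (fun k => d 0 k < 0) d; exists S => //.
  by rewrite -SE; congr rect_diag; apply/rowP=> k; rewrite !mxE -normrEsign.
have [s sE] := row_sort e.
have [P [Q [oP oQ PQ]]] := rect_diag_perm s e.
exists (\row_k e 0 (s k)); split.
  by split=> [i j ij|i]; rewrite !mxE; [have := sE i j ij; rewrite !mxE|].
exists (U *m (P *m S)^T), (V *m Q^T).
split; first exact/(orthogonalM oU)/orthogonal_tr/orthogonalM.
split; first exact/(orthogonalM oV)/orthogonal_tr.
rewrite PQ eE -dE !trmx_mul !trmxK !mulmxA.
rewrite -[_ *m P^T *m P]mulmxA oP mulmx1 -[_ *m S^T *m S]mulmxA oS mulmx1.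
rewrite -[_ *m Q^T *m Q]mulmxA oQ mulmx1 orthogonal_mulV // mul1mx.
by rewrite -mulmxA orthogonal_mulV // mulmx1.
Qed.

End SVD.

(** * Ky Fan norm bounds as linear matrix inequalities *)

Section KyFan.
Variable R : rcfType.

Definition dilation m n (M : 'M[R]_(m, n)) : 'M[R]_(m + n) :=
  block_mx 0 M M^T 0.

(** Dual form of a bound by [s] on the sum of the largest eigenvalues of the dilation, as many as
    [P] has elements. Here [Z] dominates the excess of the dilation over [t], and the sum of the
    constant [t] over [P] counts [P]. *)
Definition kyfan_lmi m n (P : pred 'I_(minn m n)) (M : 'M[R]_(m, n)) (s : R) :=
  exists (Z : 'M[R]_(m + n)) (t : R),
    [/\ psd Z, psd (Z + t%:M - dilation M) & \tr Z + \sum_(k | P k) t <= s].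

Lemma dilation_sym m n (M : 'M[R]_(m, n)) : (dilation M)^T = dilation M.
Proof. by rewrite tr_block_mx !trmx0 trmxK. Qed.

(** Conjugation by the block-diagonal matrix of [U] and [V] turns the dilation of [M] into that of
    [U *m M *m V^T]; it fixes scalar matrices and traces. *)
Lemma kyfan_lmi_orthogonal m n (P : pred 'I_(minn m n)) (M : 'M[R]_(m, n)) s U V :
  orthogonal_mx U -> orthogonal_mx V ->
  kyfan_lmi P M s -> kyfan_lmi P (U *m M *m V^T) s.
Proof.
move=> oU oV [Z [t [pZ pY trZ]]]; pose Q := block_mx U 0 0 V.
have oQ : orthogonal_mx Q by apply: orthogonal_block.
exists (Q *m Z *m Q^T), t; split.
- exact: psd_congr.
- have -> : dilation (U *m M *m V^T) = Q *m dilation M *m Q^T.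
    rewrite /Q /dilation tr_block_mx !trmx0 !mulmx_block.
    by rewrite !(mulmx0, mul0mx, addr0, add0r) !trmx_mul trmxK mulmxA.
  have -> : t%:M = Q *m t%:M *m Q^T.
    by rewrite mul_mx_scalar -scalemxAl orthogonal_mulV // scalemx1.
  by rewrite -mulmxDl -mulmxBl -mulmxDr -mulmxBr; apply: psd_congr.
- by rewrite mxtrace_mulC mulmxA oQ mul1mx.
Qed.

Lemma sum_widen_le q m (h : (q <= m)%N) (F : 'I_m -> R) :
  (forall i, 0 <= F i) -> \sum_(k < q) F (widen_ord h k) <= \sum_i F i.
Proof.
move=> F0; rewrite -big_ord_narrow big_mkcond ler_sum // => i _.
by case: ifP.
Qed.

Lemma rect_diagE m n (x : 'rV[R]_(minn m n)) : rect_diag x =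
  \sum_k x 0 k *: delta_mx (widen_ord (geq_minl m n) k)
                           (widen_ord (geq_minr m n) k).
Proof.
apply/matrixP=> i j; rewrite mxE summxE big_mkcond; apply: eq_bigr => k _.
by rewrite !mxE -!val_eqE /=; case: (_ && _); rewrite ?mulr1 ?mulr0.
Qed.

Lemma qform_outer k (w v : 'cV[R]_k) :
  qform (w *m w^T) v = ((w^T *m v) 0 0) ^+ 2.
Proof.
have -> : qform (w *m w^T) v = ((w^T *m v)^T *m (w^T *m v)) 0 0.
  by rewrite trmx_mul trmxK /qform !mulmxA.
by rewrite tr_mx11 mxE big_ord1 expr2.
Qed.

Lemma bilin_delta k l (a : 'cV[R]_k) (b : 'cV[R]_l) i j :
  (a^T *m delta_mx i j *m b) 0 0 = a i 0 * b j 0.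
Proof.
rewrite -(mul_delta_mx (0 : 'I_1)) mulmxA -mulmxA -rowE -colE mxE big_ord1.
by rewrite !mxE.
Qed.

Lemma qform_dilation_rect_diag m n (x : 'rV[R]_(minn m n)) a b :
  qform (dilation (rect_diag x)) (col_mx a b) =
  \sum_k 2 * x 0 k * (a (widen_ord (geq_minl m n) k) 0 *
                      b (widen_ord (geq_minr m n) k) 0).
Proof.
rewrite /qform tr_col_mx mul_row_block !mulmx0 add0r addr0 mul_row_col.
have -> : b^T *m (rect_diag x)^T *m a = a^T *m rect_diag x *m b.
  by rewrite -[LHS]tr_mx11 !trmx_mul !trmxK mulmxA.
rewrite -mulr2n -scaler_nat mxE rect_diagE mulmx_sumr mulmx_suml summxE.
rewrite mulr_sumr; apply: eq_bigr => k _.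
by rewrite -scalemxAr -scalemxAl mxE bilin_delta mulrA.
Qed.

Lemma qform_scalar_col m n (t : R) (a : 'cV[R]_m) (b : 'cV[R]_n) :
  qform t%:M (col_mx a b) =
  t * (\sum_i a i 0 ^+ 2 + \sum_j b j 0 ^+ 2).
Proof.
rewrite /qform mul_mx_scalar -scalemxAl tr_col_mx mul_row_col !mxE.
by congr (_ * (_ + _)); apply: eq_bigr => i _; rewrite mxE expr2.
Qed.

(* With t the last of the retained singular values, the excess of the larger
   ones over t is put on the eigenvectors (u_k, v_k) of the dilation. *)
Lemma kyfan_lmi_rect_diag m n (x : 'rV[R]_(minn m n)) (c : 'I_(minn m n)) :
  in_Delta_plus x ->
  kyfan_lmi (fun k => (k <= c)%N) (rect_diag x)
    (\sum_(k < minn m n | (k <= c)%N) x 0 k).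
Proof.
move=> [xS x0]; pose t := x 0 c.
pose il := widen_ord (geq_minl m n); pose ir := widen_ord (geq_minr m n).
pose w k : 'cV[R]_(m + n) := col_mx (delta_mx (il k) 0) (delta_mx (ir k) 0).
pose Z := \sum_(k < minn m n | (k <= c)%N) ((x 0 k - t) / 2) *: (w k *m (w k)^T).
have pZ : psd Z.
  apply: psd_sum => k kc; apply: psdZ (psd_outer _).
  by rewrite divr_ge0 // subr_ge0 xS.
exists Z, t; split=> //.
- split; first by rewrite /symmetric_mx linearB linearD /= tr_scalar_mx
    dilation_sym (proj1 pZ).
  move=> v; rewrite -/(qform _ _) -[v]vsubmxK.
  move: (usubmx v) (dsubmx v) => a b.
  rewrite -scaleN1r !qformD qformZ qform_dilation_rect_diag qform_scalar_col.
  have -> : qform Z (col_mx a b) = \sum_(k < minn m n)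
     (if (k <= c)%N then (x 0 k - t) / 2 * (a (il k) 0 + b (ir k) 0) ^+ 2 else 0).
    rewrite qform_sum big_mkcond; apply: eq_bigr => k _; case: ifP => // _.
    rewrite qformZ qform_outer /w tr_col_mx mul_row_col !trmx_delta mxE.
    by rewrite -!rowE !mxE.
  (* Coordinates beyond the diagonal only add [t] times squares, so the form splits into one binary
     form for each [k]. *)
  have le1 : t * (\sum_k a (il k) 0 ^+ 2 + \sum_k b (ir k) 0 ^+ 2) <=
      t * (\sum_i a i 0 ^+ 2 + \sum_j b j 0 ^+ 2).
    rewrite ler_wpM2l ?x0 // lerD //.
      by apply: (sum_widen_le _ (F := fun i => a i 0 ^+ 2)) => i; apply: sqr_ge0.
    by apply: (sum_widen_le _ (F := fun i => b i 0 ^+ 2)) => i; apply: sqr_ge0.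
  rewrite mulN1r -addrA; apply: le_trans (lerD (lexx _) (lerB le1 (lexx _))).
  rewrite -big_split /= mulr_sumr -sumrB -big_split /=; apply: sumr_ge0 => k _.
  move: (a _ _) (b _ _) => ak bk; have := x0 k; have := x0 c; rewrite -/t.
  move: (xS k c) (xS c k); rewrite -/t; move: (x 0 k) (t) => xk t'.
  (* For [k <= c] the excess in [Z] completes the square. For [k > c], [Z] contributes nothing, and
     [xk <= t'] makes the form a sum of two squares with nonnegative weights. *)
  case: leqP => kc le2 le3 t0 xk0.
    have -> : (xk - t') / 2 * (ak + bk) ^+ 2 +
       (t' * (ak ^+ 2 + bk ^+ 2) - 2 * xk * (ak * bk))
       = (xk + t') / 2 * (ak - bk) ^+ 2 by field.
    by rewrite mulr_ge0 ?sqr_ge0 // divr_ge0 // addr_ge0.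
  have {}le3 := le3 (ltnW kc).
  have -> : 0 + (t' * (ak ^+ 2 + bk ^+ 2) - 2 * xk * (ak * bk))
     = (t' - xk) / 2 * (ak + bk) ^+ 2 + (t' + xk) / 2 * (ak - bk) ^+ 2 by field.
  by rewrite addr_ge0 // mulr_ge0 ?sqr_ge0 // divr_ge0 ?subr_ge0 // addr_ge0.
- rewrite linear_sum -big_split /= ler_sum // => k _.
  rewrite mxtraceZ mxtrace_mulC trace_mx11 /w tr_col_mx mul_row_col !trmx_delta.
  rewrite !mul_delta_mx !mxE !eqxx /=.
  have -> : (x 0 k - t) / 2 * (1 + 1) = x 0 k - t by field.
  by rewrite subrK.
Qed.

Lemma qform_pair m n (Z : 'M[R]_(m + n)) i j (c : R) :
  qform Z (col_mx (delta_mx i 0) (c *: delta_mx j 0)) =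
  Z (lshift n i) (lshift n i) + c * Z (lshift n i) (rshift m j)
  + c * Z (rshift m j) (lshift n i) + c ^+ 2 * Z (rshift m j) (rshift m j).
Proof.
have dZ p q : (delta_mx p 0 : 'cV_(m + n))^T *m Z *m
    (delta_mx q 0 : 'cV_(m + n)) = (Z p q)%:M.
  by rewrite [LHS]mx11_scalar trmx_delta -rowE -colE !mxE.
have -> : col_mx (delta_mx i 0) (c *: delta_mx j 0) =
    delta_mx (lshift n i) 0 + c *: delta_mx (rshift m j) 0 :> 'cV_(m + n).
  apply/colP=> p; rewrite -[p]splitK; case: (split p) => l /=.
    by rewrite col_mxEu !mxE eq_lshift eq_lrshift /= mulr0 addr0.
  by rewrite col_mxEd !mxE eq_rlshift eq_rshift /= add0r.
rewrite /qform [(_ + _)^T]linearD /= [(_ *: _)^T]linearZ /=.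
rewrite !(mulmxDl, mulmxDr) -!scalemxAl -!scalemxAr !dZ.
by rewrite !mxE !mulr1n; ring.
Qed.

Lemma psd_diag_ge0 k (Z : 'M[R]_k) i : psd Z -> 0 <= Z i i.
Proof.
by move=> [_ /(_ (delta_mx i 0))]; rewrite trmx_delta -rowE -colE !mxE.
Qed.

(** Test [Z + t I - Y] on the sum of the two basis vectors paired by [k], and [Z] on their
    difference. Adding cancels the off-diagonal entries of [Z] and bounds [x 0 k] by two diagonal
    entries of [Z] plus [t]. Over all [k] these diagonal entries add up to at most the trace. *)
Lemma kyfan_lmi_le m n (P : pred 'I_(minn m n)) (x : 'rV[R]_(minn m n)) s :
  kyfan_lmi P (rect_diag x) s -> \sum_(k | P k) x 0 k <= s.
Proof.
move=> [Z [t [pZ pY]]]; apply: le_trans.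
pose il k := lshift n (widen_ord (geq_minl m n) k).
pose ir k := rshift m (widen_ord (geq_minr m n) k).
have xle k : x 0 k <= Z (il k) (il k) + Z (ir k) (ir k) + t.
  have := psd_qform (col_mx (delta_mx (widen_ord (geq_minl m n) k) 0)
    ((-1) *: delta_mx (widen_ord (geq_minr m n) k) 0)) pZ.
  have := psd_qform (col_mx (delta_mx (widen_ord (geq_minl m n) k) 0)
    (1 *: delta_mx (widen_ord (geq_minr m n) k) 0)) pY.
  rewrite !qform_pair -/(il k) -/(ir k).
  have E p q : (Z + t%:M - dilation (rect_diag x)) p q =
      Z p q + t *+ (p == q) - dilation (rect_diag x) p q by rewrite !mxE.
  rewrite !E /dilation block_mxEul block_mxEur block_mxEdl block_mxEdr.
  rewrite [_^T _ _]mxE !(@rect_diag_id _ _ _ _ k) // !mxE !eqxx.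
  rewrite eq_lrshift eq_rlshift /= => h1 h2; lra.
apply: le_trans (ler_sum _ (fun k _ => xle k)) _.
rewrite big_split /= lerD // /mxtrace big_split_ord /= big_split /=.
have h q0 (F : 'I_q0 -> R) (Q : pred 'I_q0) : (forall k, 0 <= F k) ->
    \sum_(k | Q k) F k <= \sum_k F k.
  by move=> F0; rewrite [leLHS]big_mkcond ler_sum // => k _; case: ifP.
by apply: lerD; (apply: le_trans (h _ _ _ _) _ => [k|]; last
  apply: (sum_widen_le _ (F := fun i => Z (_ i) (_ i)))) => *;
  apply: psd_diag_ge0.
Qed.

End KyFan.

(** * Weak majorization in convex sets invariant under permutations and sign changes *)

Section Majorization.
Variables (R : rcfType) (q : nat) (G : 'rV[R]_q -> Prop).
Hypothesis G_convex : forall (a : R) x y,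
  0 <= a <= 1 -> G x -> G y -> G (a *: x + (1 - a) *: y).
Hypothesis G_sign : forall (c : pred 'I_q) x,
  G x -> G (\row_k ((-1) ^+ c k * x 0 k)).
Hypothesis G_perm : forall (s : 'S_q) x, G x -> G (\row_k x 0 (s k)).

(** The result lies on the segment from [u] to its reflection in coordinate [j]; the weight solves
    [(2 l - 1) u_j = a]. *)
Lemma shrink_coord (u : 'rV[R]_q) (j : 'I_q) (a : R) : 0 <= a < u 0 j -> G u ->
  G (\row_k (if k == j then a else u 0 k)).
Proof.
move=> /andP[a0 au] Gu; have uj0 : 0 < u 0 j by apply: le_lt_trans au.
have a1 : 0 <= a / u 0 j <= 1.
  apply/andP; split; first by rewrite divr_ge0 // ltW.
  by rewrite ler_pdivrMr // mul1r ltW.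
have l01 : 0 <= (1 + a / u 0 j) / 2 <= 1 by lra.
have := G_convex l01 Gu (G_sign (pred1 j) Gu).
congr G; apply/rowP=> k; rewrite !mxE /=; case: eqP => [->|_].
  by field; rewrite gt_eqF.
by rewrite expr0 mul1r; ring.
Qed.

(** The result lies on the segment from [u] to its image under the swap of [i] and [j]. *)
Lemma transfer (u : 'rV[R]_q) (i j : 'I_q) (d : R) : 0 <= d -> d < u 0 i - u 0 j -> G u ->
  G (\row_k (u 0 k + d * ((k == j)%:R - (k == i)%:R))).
Proof.
move=> d0 dl Gu; pose l := d / (u 0 i - u 0 j).
have D0 : 0 < u 0 i - u 0 j by apply: le_lt_trans dl.
have l01 : 0 <= l <= 1.
  apply/andP; split; first by rewrite divr_ge0 // ltW.
  by rewrite ler_pdivrMr // mul1r ltW.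
have := G_convex l01 (G_perm (tperm i j) Gu) Gu.
have ij : i != j by apply: contraTneq D0 => ->; rewrite subrr ltxx.
have dE : d = l * (u 0 i - u 0 j) by rewrite /l divfK // gt_eqF.
congr G; apply/rowP=> k; rewrite !mxE dE.
case: tpermP => [->|->|/eqP/negPf-> /eqP/negPf->].
- by rewrite eqxx (negPf ij) /=; ring.
- by rewrite eqxx eq_sym (negPf ij) /=; ring.
- by rewrite /=; ring.
Qed.

(* Induction on the number of coordinates where x and u differ. At the first j
   with u_j < x_j some earlier i has x_i < u_i, and a Robin Hood transfer from
   i to j makes one of the two coordinates agree; it keeps the prefix sums of u
   above those of x because x <= u before j. If there is no such j,
   shrink a coordinate of u. *)
Lemma weak_majorization (x u : 'rV[R]_q) : in_Delta_plus x ->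
  (forall c : 'I_q, \sum_(k < q | (k <= c)%N) x 0 k <=
                    \sum_(k < q | (k <= c)%N) u 0 k) ->
  G u -> G x.
Proof.
move=> [xS x0]; have [N] := ubnP #|[pred k | x 0 k != u 0 k]|.
elim: N u => // N IHN u; rewrite ltnS => cardN xu Gu.
(* Progress measure: keeping all agreements with [x] and gaining one at [i] lowers the number of
   disagreements. *)
have sub (u' : 'rV[R]_q) i : (forall k, x 0 k = u 0 k -> u' 0 k = u 0 k) ->
    x 0 i != u 0 i -> x 0 i = u' 0 i ->
    (#|[pred k | (x 0 k != u' 0 k)%R]| < N)%N.
  move=> uu' xi xi'; apply: leq_trans cardN; apply: proper_card.
  apply/properP; split; last by exists i; rewrite !inE // xi' eqxx.
  by apply/subsetP=> k; rewrite !inE; apply: contraNneq => e; rewrite uu' // e.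
have [j0 j0P|xleu] := pickP (fun j => u 0 j < x 0 j); last first.
  have {}xleu k : x 0 k <= u 0 k by rewrite leNgt xleu.
  have [j jP|xu0] := pickP (fun j => x 0 j < u 0 j); last first.
    suff -> : x = u by [].
    by apply/rowP=> k; apply/eqP; rewrite eq_le xleu leNgt xu0.
  apply: (IHN (\row_k (if k == j then x 0 j else u 0 k))).
  - apply: (sub _ j); rewrite ?mxE ?eqxx ?lt_eqF // => k xk.
    by rewrite mxE; case: eqP xk => // ->.
  - move=> c; apply: ler_sum => k _; rewrite mxE; case: eqP => [->|] //.
  - by apply: shrink_coord; rewrite ?x0.
have [j jP jmin] := @arg_minnP _ j0 (fun j => u 0 j < x 0 j) val j0P.
have xleu (k : 'I_q) : (k < j)%N -> x 0 k <= u 0 k.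
  by move=> kj; rewrite leNgt; apply/negP => /jmin; rewrite leqNgt kj.
have [i /andP[ij iP]|noi] := pickP (fun i : 'I_q => (i < j)%N && (x 0 i < u 0 i));
  last first.
  (* Without such an [i], [u <= x] before [j] and [u_j < x_j], against the prefix inequality at
     [j]. *)
  have := xu j; rewrite leNgt => /negP[].
  rewrite (bigD1 j) //= [ltRHS](bigD1 j) //= ltr_leD // ler_sum // => k /andP[kj kNj].
  by have := noi k; rewrite ltn_neqAle kNj kj /= => /negbT; rewrite -leNgt.
have xij : x 0 j <= x 0 i by apply: xS; apply: ltnW.
pose d := Num.min (u 0 i - x 0 i) (x 0 j - u 0 j).
have d0 : 0 < d by rewrite lt_min !subr_gt0 iP jP.
have di : d <= u 0 i - x 0 i by rewrite ge_min lexx.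
have dj : d <= x 0 j - u 0 j by rewrite ge_min lexx orbT.
have inj : i != j by rewrite -val_eqE /= ltn_eqF.
pose u' : 'rV_q := \row_k (u 0 k + d * ((k == j)%:R - (k == i)%:R)).
have u'i : u' 0 i = u 0 i - d by rewrite mxE eqxx (negPf inj) /=; ring.
have u'j : u' 0 j = u 0 j + d by rewrite mxE eqxx eq_sym (negPf inj) /=; ring.
have u'k k : k != i -> k != j -> u' 0 k = u 0 k.
  by move=> /negPf ki /negPf kj; rewrite mxE ki kj /=; ring.
apply: (IHN u').
- have uu' k : x 0 k = u 0 k -> u' 0 k = u 0 k.
    by move=> xk; apply: u'k; apply: contra_eqN xk => /eqP->;
      rewrite ?(lt_eqF iP) ?(gt_eqF jP).
  have [dE|dE] : d = u 0 i - x 0 i \/ d = x 0 j - u 0 j.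
  + by rewrite /d; case: leP; [left|right].
  + by apply: (sub _ i); rewrite ?lt_eqF // u'i dE; ring.
  + by apply: (sub _ j); rewrite ?gt_eqF // u'j dE; ring.
- move=> c; have [jc|cj] := leqP j c; last first.
    apply: ler_sum => k kc; have kj := leq_ltn_trans kc cj.
    have [->|ki] := eqVneq k i; first by rewrite u'i; lra.
    by rewrite u'k ?xleu // -val_eqE /= ltn_eqF.
  (* A prefix reaching [j] also contains [i], so the transfer leaves its sum unchanged. *)
  have s1 (l : 'I_q) : (l <= c)%N -> \sum_(k < q | (k <= c)%N) (k == l)%:R = 1 :> R.
    move=> lc; rewrite (bigD1 l) //= eqxx big1 ?addr0 // => k.
    by case/andP=> _ /negPf->.
  under [leRHS]eq_bigr do rewrite mxE.
  rewrite [leRHS]big_split /= -mulr_sumr sumrB !s1 //.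
    by rewrite subrr mulr0 addr0 xu.
  exact: leq_trans (ltnW ij) jc.
(* The strict bound on [d] comes from [d <= u_i - x_i <= u_i - x_j < u_i - u_j]. *)
- by apply: transfer => //; lra.
Qed.

End Majorization.

(** * Convex hulls of sets of matrices *)

Section ConvexHull.
Variables (R : rcfType) (m n : nat) (S : 'M[R]_(m, n) -> Prop).

Lemma conv_hull_sub M : S M -> conv_hull S M.
Proof.
move=> SM; exists 1, (fun=> 1), (fun=> M); split; first by move=> _; exact: ler01.
by rewrite !big_ord1 scale1r.
Qed.

Lemma conv_hull_convex a M N : 0 <= a <= 1 ->
  conv_hull S M -> conv_hull S N -> conv_hull S (a *: M + (1 - a) *: N).
Proof.
move=> /andP[a0 a1] [s [l [X [l0 [l1 [SX ->]]]]]] [t [k [Y [k0 [k1 [SY ->]]]]]].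
exists (s + t)%N,
  (fun i => match split i with inl i => a * l i | inr j => (1 - a) * k j end),
  (fun i => match split i with inl i => X i | inr j => Y j end).
have sl i : split (lshift t i : 'I_(s + t)) = inl i.
  by rewrite -[lshift t i]/(unsplit (inl i)) unsplitK.
have sr j : split (rshift s j : 'I_(s + t)) = inr j.
  by rewrite -[rshift s j]/(unsplit (inr j)) unsplitK.
split; first by move=> i; case: split => j; rewrite mulr_ge0 ?subr_ge0.
split.
  rewrite big_split_ord /=; under eq_bigr do rewrite sl.
  under [X in _ + X]eq_bigr do rewrite sr.
  by rewrite -!mulr_sumr l1 k1 !mulr1 subrKC.
split; first by move=> i; case: split.
rewrite [RHS]big_split_ord /= !scaler_sumr.
by congr (_ + _); apply: eq_bigr => i _; rewrite ?sl ?sr scalerA.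
Qed.

Lemma conv_hull_orthogonal U V :
  (forall M, S M -> S (U *m M *m V^T)) ->
  forall M, conv_hull S M -> conv_hull S (U *m M *m V^T).
Proof.
move=> SUV M [s [l [X [l0 [l1 [SX ->]]]]]].
exists s, l, (fun i => U *m X i *m V^T); do 2! [split=> //]; split=> [i|].
  exact: SUV.
rewrite mulmx_sumr mulmx_suml; apply: eq_bigr => i _.
by rewrite -scalemxAr -scalemxAl.
Qed.

End ConvexHull.

(** * Rank, orthogonal invariance and joint representability of the Ky Fan constraints *)

Section SpectralSets.
Variables (R : rcfType) (m n : nat).
Implicit Types (x u : 'rV[R]_(minn m n)) (M : 'M[R]_(m, n)).

(** Right multiplication by a coordinate projector factoring through dimension [K] leaves the matrix
    unchanged. *)
Lemma rank_rect_diag_le K x :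
  (forall k : 'I_(minn m n), (K <= k)%N -> x 0 k = 0) ->
  (\rank (rect_diag x) <= K)%N.
Proof.
move=> xK; pose Q := (pid_mx K : 'M[R]_(n, K)) *m (pid_mx K : 'M[R]_(K, n)).
have -> : rect_diag x = rect_diag x *m Q.
  apply/matrixP=> i j; rewrite /Q mul_pid_mx !minnn [RHS]mxE (bigD1 j) //= big1.
    rewrite [pid_mx _ _ _]mxE eqxx /= addr0; case: ltnP => [_|Kj].
      by rewrite mulr1.
    rewrite mulr0; have [ij|] := eqVneq (i : nat) j; last exact: rect_diag_off.
    have jq : (j < minn m n)%N by rewrite leq_min ltn_ord -ij ltn_ord.
    by rewrite (@rect_diag_id _ _ _ _ (Ordinal jq)) // xK.
  by move=> l lj; rewrite [pid_mx _ _ _]mxE val_eqE (negPf lj) mulr0.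
exact: leq_trans (mxrankM_maxr _ _) (mulmx_max_rank _ _).
Qed.

(** If [x 0 k] were nonzero, so would be all earlier entries, and the leading square block of size
    [k + 1], cut out by [P] and [Q], would be invertible; the rank would then exceed [K]. *)
Lemma sing_vals_rank K M x (k : 'I_(minn m n)) :
  is_sing_vals M x -> (\rank M <= K)%N -> (K <= k)%N -> x 0 k = 0.
Proof.
move=> [[xS x0] [U [V [oU [oV ME]]]]] rM Kk; apply/eqP/negPn/negP => xk.
pose il := widen_ord (geq_minl m n); pose ir := widen_ord (geq_minr m n).
pose h : 'I_k.+1 -> 'I_(minn m n) := widen_ord (ltn_ord k).
pose P := rowsub (il \o h) 1%:M : 'M[R]_(_, m).
pose Q := colsub (ir \o h) 1%:M : 'M[R]_(n, _).
have DE : rect_diag x = U^T *m M *m V.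
  by rewrite ME !mulmxA oU mul1mx -mulmxA oV mulmx1.
have PDQ : P *m rect_diag x *m Q = diag_mx (\row_l x 0 (h l)).
  rewrite -rowsubE mulmx_colsub mulmx1; apply/matrixP=> i j; rewrite !mxE.
  have [->|ij] := eqVneq i j; first by rewrite mulr1n (big_pred1 (h j)) // => l;
    rewrite /= andbb -val_eqE eq_sym.
  rewrite mulr0n big_pred0 // => l /=; apply: contraNF ij.
  by move=> /andP[/eqP il' /eqP jl]; apply/eqP/val_inj; rewrite /= il' jl.
have /mxrank_unit : P *m rect_diag x *m Q \in unitmx.
  rewrite PDQ unitmxE det_diag unitfE; apply/prodf_neq0 => l _; rewrite mxE.
  rewrite gt_eqF //; apply: lt_le_trans (xS (h l) k _); last exact: (ltn_ord l).
  by rewrite lt_neqAle eq_sym xk x0.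
apply/eqP; rewrite ltn_eqF // ltnS; apply: leq_trans Kk.
apply: leq_trans (mxrankM_maxl _ _) _; apply: leq_trans (mxrankM_maxr _ _) _.
rewrite DE; apply: leq_trans (mxrankM_maxl _ _) _.
exact: leq_trans (mxrankM_maxr _ _) _.
Qed.

Lemma Sbar_orthogonal K (f : 'rV[R]_(minn m n) -> R) r U V M :
  orthogonal_mx U -> orthogonal_mx V ->
  Sbar K f r M -> Sbar K f r (U *m M *m V^T).
Proof.
move=> oU oV [rM [x [[xD [A [B [oA [oB ME]]]]] fx]]]; split.
  apply: leq_trans rM; apply: leq_trans (mxrankM_maxl _ _) _.
  exact: mxrankM_maxr.
exists x; split=> //; split=> //; exists (U *m A), (V *m B).
do 2! [split; first exact: orthogonalM].
by rewrite ME trmx_mul !mulmxA.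
Qed.

(** The bound is itself linear in the second component, so the constraint is a joint one on matrix
    and vector. A representation needs symmetric values at every lifting variable, hence [Z] is
    parametrized as [W + W^T] with [W] free. *)
Lemma lmi_rep_kyfan (P : pred 'I_(minn m n)) :
  lmi_rep (fun p : 'M[R]_(m, n) * 'rV[R]_(minn m n) =>
             kyfan_lmi P p.1 (\sum_(k | P k) p.2 0 k)).
Proof.
pose sym (W : 'M[R]_(m + n)) := W + W^T.
have symL : linear sym.
  move=> a u v; rewrite /sym linearP /= scalerDr; exact: addrACA.
have symT W : (sym W)^T = sym W by rewrite /sym linearD /= trmxK addrC.
have symK Z : symmetric_mx Z -> sym (2^-1 *: Z) = Z.
  move=> sZ; rewrite /sym linearZ /= sZ -scalerDl.
  have -> : 2^-1 + 2^-1 = 1 :> R by field.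
  by rewrite scale1r.
pose V := (('M[R]_(m, n) * 'rV[R]_(minn m n)) * ('M[R]_(m + n) * R^o))%type.
apply: (@lmi_rep_ext _ _ (fun p : 'M[R]_(m, n) * 'rV[R]_(minn m n) =>
  exists z : 'M[R]_(m + n) * R^o,
  psd (sym z.1) /\ (psd (sym z.1 + z.2%:M - dilation p.1) /\
  0 <= \sum_(k | P k) p.2 0 k - (\tr (sym z.1) + \sum_(k | P k) z.2)))).
  move=> p; split=> [[[W t] /= [pW [pY tr]]]|[Z [t [pZ pY tr]]]].
    by exists (sym W), t; split=> //; rewrite -subr_ge0.
  exists (2^-1 *: Z, t); rewrite /= symK; last by case: pZ.
  by do 2! [split=> //]; rewrite subr_ge0.
pose S (v : V) := psd (sym v.2.1) /\ (psd (sym v.2.1 + v.2.2%:M - dilation v.1.1) /\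
  0 <= \sum_(k | P k) v.1.2 0 k - (\tr (sym v.2.1) + \sum_(k | P k) v.2.2)).
apply: (@lmi_rep_proj _ _ _ S); apply: lmi_rep_and; last apply: lmi_rep_and.
- by apply: lmi_rep_psd => [a u v|v]; [exact: symL | exact: symT].
- apply: lmi_rep_psd => [a u v|v].
    have sc : (a *: u.2.2 + v.2.2)%:M = a *: u.2.2%:M + v.2.2%:M :> 'M[R]_(m + n).
      by rewrite scale_scalar_mx; exact: raddfD.
    rewrite /= symL sc.
    have -> : dilation (a *: u.1.1 + v.1.1) = a *: dilation u.1.1 + dilation v.1.1.
      rewrite /dilation scale_block_mx add_block_mx !scaler0 !addr0.
      by rewrite linearP.
    rewrite opprD scalerBr [in RHS]addrACA; congr (_ + _).
    rewrite [a *: (_ + u.2.2%:M)]scalerDr; exact: addrACA.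
  rewrite /symmetric_mx linearB linearD /= tr_scalar_mx dilation_sym.
  by rewrite symT.
- apply: (@lmi_rep_ge0 _ _ (fun v : V =>
    \sum_(k | P k) v.1.2 0 k - (\tr (sym v.2.1) + \sum_(k | P k) v.2.2))) => a u v.
  rewrite /= symL mxtraceD mxtraceZ big_split /= -mulr_sumr.
  under eq_bigr do rewrite !mxE; rewrite big_split /= -mulr_sumr.
  by rewrite /GRing.scale /=; ring.
Qed.

End SpectralSets.

(** * Identification of the hull with the representable majorization set *)

Theorem mainTheorem11 (R : rcfType) (m n K : nat)
  (hm : (0 < m)%N) (hn : (0 < n)%N) (hK : (0 < K)%N)
  (r : R) (f : 'rV[R]_(minn m n) -> R)
  (hf : forall t : R, sdr (fun u : 'rV[R]_(minn m n) => in_Delta_plus u /\ f u <= t)) :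
  sdr_mx (conv_hull (Sbar K f r)).
Proof.
(* The second component is the majorizing vector [u]. As its entries are nonnegative, the single
   inequality on the tail sum forces them to vanish from index [K] on. *)
pose T0 (p : 'M[R]_(m, n) * 'rV[R]_(minn m n)) :=
  (in_Delta_plus p.2 /\ f p.2 <= r) /\
  (0 <= - \sum_(k < minn m n | (K <= k)%N) p.2 0 k /\
   forall c : 'I_(minn m n), kyfan_lmi (fun k : 'I_(minn m n) => (k <= c)%N) p.1
     (\sum_(k < minn m n | (k <= c)%N) p.2 0 k)).
pose T M := exists u, T0 (M, u).
have lmiT : lmi_rep T.
  apply: lmi_rep_proj; apply: lmi_rep_and.
    by apply: (lmi_rep_preim (g := snd)) (iffLR (sdr_lmi_rep _) (hf r)).
  apply: lmi_rep_and; last first.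
    by apply: lmi_rep_all => c; apply: lmi_rep_kyfan.
  apply: (@lmi_rep_ge0 _ _ (fun p : 'M[R]_(m, n) * 'rV[R]_(minn m n) =>
    - \sum_(k < minn m n | (K <= k)%N) p.2 0 k)).
  move=> a u v /=; under eq_bigr do rewrite !mxE.
  by rewrite big_split /= -mulr_sumr opprD -mulrN.
have convT M : conv_hull (Sbar K f r) M <-> T M.
  split=> [[s [l [X [l0 [l1 [SX ->]]]]]]|].
    (* [T] is convex, so only points of [Sbar] matter; there [u] is the vector of singular values
       itself. *)
    apply: (lmi_rep_convex lmiT) => // i.
    have [rX [x [sx fx]]] := SX i; exists x; have [xD [U [V [oU [oV XE]]]]] := sx.
    do 2! [split=> //].
      rewrite big1 ?oppr0 // => k Kk; exact: sing_vals_rank sx rX Kk.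
    move=> c; rewrite XE; apply: kyfan_lmi_orthogonal => //.
    exact: kyfan_lmi_rect_diag.
  move=> [u [[uD fu] [uK ku]]].
  have [x [xD [U [V [oU [oV ME]]]]]] := svd_exists M.
  have hull_orth A B : orthogonal_mx A -> orthogonal_mx B -> forall N,
      conv_hull (Sbar K f r) N -> conv_hull (Sbar K f r) (A *m N *m B^T).
    by move=> oA oB; apply: conv_hull_orthogonal => N; apply: Sbar_orthogonal.
  rewrite ME; apply: (hull_orth U V) => //.
  (* Majorization is applied to the vectors whose diagonal matrix lies in the hull. *)
  apply: (weak_majorization (G := fun x => conv_hull (Sbar K f r) (rect_diag x))
    _ _ _ xD (u := u)).
  - move=> a y z a01 Gy Gz; have := conv_hull_convex a01 Gy Gz.
    congr conv_hull; rewrite !rect_diagE !scaler_sumr -big_split /=.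
    by apply: eq_bigr => k _; rewrite !scalerA -scalerDl !mxE.
  - move=> c y Gy; have [S oS ->] := rect_diag_sign c y.
    by have := hull_orth _ _ oS (orthogonal1 _ _) _ Gy; rewrite trmx1 mulmx1.
  - by move=> s y Gy; have [A [B [oA oB ->]]] := rect_diag_perm s y; apply: hull_orth.
  - move=> c; apply: kyfan_lmi_le.
    (* The inequality for [M] is carried back to its diagonal form, where it bounds the prefix sums
       of [x]. *)
    have := kyfan_lmi_orthogonal (orthogonal_tr oU) (orthogonal_tr oV) (ku c).
    by rewrite trmxK ME !mulmxA oU mul1mx -mulmxA oV mulmx1.
  (* It remains that the diagonal matrix of [u] lies in [Sbar]: the vanishing tail bounds its rank,
     and [u] is its vector of singular values. *)
  apply: conv_hull_sub; split.
    apply: rank_rect_diag_le => k Kk; have u0 := proj2 uD.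
    move: uK; rewrite oppr_ge0 => uK.
    have : \sum_(k < minn m n | (K <= k)%N) u 0 k == 0 by rewrite eq_le uK sumr_ge0.
    by rewrite psumr_eq0 // => /allP/(_ k (mem_index_enum k))/implyP/(_ Kk)/eqP.
  exists u; split=> //; split=> //; exists 1%:M, 1%:M.
  do 2! [split; first exact: orthogonal1].
  by rewrite trmx1 mulmx1 mul1mx.
apply/sdr_lmi_rep; apply: (@lmi_rep_preim _ _ _ vec_mx).
  exact: linearP.
by apply: lmi_rep_ext lmiT => M; rewrite convT.
Qed.
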